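(* Let $q$ be a prime power, let $k,s,t$ be positive integers, let $d$ be an even integer with $2\le d\le 2k$, and put $r=k-\tfrac d2$. Let $\left(\mathcal{C}_0,\dots,\mathcal{C}_r\right)$ be a distance-partition of a $(k+t,\star,d;k)_q$-CDC $\mathcal{C}$ and let $\left(\mathcal{D}_0,\dots,\mathcal{D}_r\right)$ be a $(k+s,d,k)$-sequence. If $\mathcal{A}$ is an $(s,\star,d;k)_q$-CDC, then there exists a $(k+s+t,\star,d;k)_q$-CDC $\mathcal{C}'$ with cardinality $$\#\mathcal{C}'=\#\mathcal{A}+\sum_{i=0}^r \#\mathcal{C}_i\cdot\#\mathcal{D}_{r-i}.$$
   Context: The subspace distance between subspaces $U,U'$ of $\mathbb{F}_q^n$ is $d(U,U')=\dim(U+U')-\dim(U\cap U')$. An $(n,\star,d;k)_q$-CDC (constant-dimension code) is a set of $k$-dimensional subspaces of $\mathbb{F}_q^n$ (called codewords) any two distinct elements of which have subspace distance at least $d$; the symbol $\star$ means that the cardinality is not specified. Two subspaces are called disjoint if they intersect trivially. An $(n,d,k)$-sequence of CDCs is a list $(\mathcal{D}_0,\dots,\mathcal{D}_r)$, where $r=k-\tfrac d2$, of $(n,\star,d;k)_q$-CDCs such that for each $0\le i\le r$ there exist a codeword $U\in\mathcal{D}_i$ and an $(n-k)$-dimensional subspace $S$ of $\mathbb{F}_q^n$ disjoint from $U$ such that $\dim(U'\cap S)\le i$ for all $U'\in\mathcal{D}_i$. A list $(\mathcal{C}_0,\dots,\mathcal{C}_r)$, where $r=k-\tfrac d2$, is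 a distance-partition of an $(n,\star,d;k)_q$-CDC $\mathcal{C}$ if $\mathcal{C}_0,\dots,\mathcal{C}_r$ is a partition of $\mathcal{C}$ (empty parts are allowed) and $\bigcup_{j=0}^i\mathcal{C}_j$ is an $(n,\star,2k-2i;k)_q$-CDC for all $0\le i\le r$. *)

(* Defs.v *)
From mathcomp Require Import all_boot all_algebra.
From mathcomp Require Import finmap.

Set Implicit Arguments.
Unset Strict Implicit.
Unset Printing Implicit Defensive.

Section ConstantDimensionCodes.

(* The field is F_q with q = #|F|; its ambient space F_q^n is 'rV[F]_n. *)
Variables (F : finFieldType) (n : nat).

Local Notation subspace := {vspace 'rV[F]_n}.

(* The truncated subtraction is harmless, as U :&: V is contained in U + V. *)
Definition subspace_dist (U V : subspace) : nat :=
  \dim (U + V) - \dim (U :&: V).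

Definition disjoint_subspaces (U V : subspace) : Prop := (U :&: V = 0)%VS.

Definition is_CDC (d k : nat) (C : {fset subspace}) : Prop :=
  (forall U, U \in C -> \dim U = k) /\
  (forall U V, U \in C -> V \in C -> U != V -> d <= subspace_dist U V).

(* Lists of length r + 1, with r = k - d/2, are families over 'I_r.+1. *)
Definition is_CDC_sequence (d k : nat)
    (D : 'I_(k - d./2).+1 -> {fset subspace}) : Prop :=
  forall i, is_CDC d k (D i) /\
    exists U S : subspace,
      [/\ U \in D i, \dim S = n - k, disjoint_subspaces U S &
          forall U', U' \in D i -> \dim (U' :&: S) <= i].

Definition is_distance_partition (d k : nat) (C : {fset subspace})
    (Cs : 'I_(k - d./2).+1 -> {fset subspace}) : Prop :=
  [/\ C = \big[fsetU/fset0]_(i < (k - d./2).+1) Cs i,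
      (forall i j, i != j -> [disjoint Cs i & Cs j]%fset) &
      (forall i : 'I_(k - d./2).+1,
         is_CDC (2 * k - 2 * i) k
           (\big[fsetU/fset0]_(j < (k - d./2).+1 | j <= i) Cs j))].

End ConstantDimensionCodes.

Arguments is_CDC_sequence {F n} d k D.
Arguments is_distance_partition {F n} d k C Cs.

(* Main.v *)
Require Import Defs.
From HB Require Import structures.
From mathcomp Require Import all_boot all_algebra.
From mathcomp Require Import finmap.
From mathcomp Require Import zify.

(** Write V = F^(k+s) and r = k - d/2, and let S_j be the s-dimensional space
    that comes with D_j.  For j = r - i and a codeword W of C_i choose a linear
    map phi : V -> F^(k+t) with kernel S_j and image W, and a linear map
    sigma : V -> F^s whose kernel is a complement of S_j.  The map
    v |-> (phi v, sigma v) into F^(k+t) x F^s is injective, so it sends each U in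
    D_j to a k-dimensional space X(i, W, U).  The new code consists of all these
    spaces and of the spaces 0 x U with U in A.

    For k-dimensional spaces, distance at least d means that the intersection
    has dimension at most r, so it remains to bound intersections.  Projecting
    X(i, W, U) :&: X(i', W', U') to F^(k+t) lands in W :&: W', and the kernel of
    this projection comes from U :&: S_j; this is [dim_glue_cap].  If W != W',
    let i be the larger of the two indices: by the distance-partition
    dim (W :&: W') <= i, by the choice of S_j the kernel has dimension at most
    r - i, and the sum is at most r.  If W = W', then i = i', and the
    injective map above preserves the intersection of U and U'.  The spaces
    0 x U meet X(i', W', U') only in the kernel part, and meet each other as
    the codewords of A do.  As r < k, spaces that
    come from different data are distinct, which gives the cardinality. *)

(** * Linear maps with prescribed kernel and image *)

Section KernelImage.

Set Implicit Arguments.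
Unset Strict Implicit.
Unset Printing Implicit Defensive.

Import GRing.Theory.
Local Open Scope ring_scope.

Variables (K : fieldType) (aT rT : vectType K).

(** A linear map with kernel S and image W, provided that the dimensions are
    compatible: it sends a basis of a complement of S to a basis of W, and a
    basis of S to 0. *)
Definition hom_ker_img (S : {vspace aT}) (W : {vspace rT}) : 'Hom(aT, rT) :=
  linfun (sval (linear_of_free (vbasis S^C%VS ++ vbasis S)
                               (vbasis W ++ nseq (\dim S) 0))).

Lemma hom_ker_imgP (S : {vspace aT}) (W : {vspace rT}) :
  (\dim S + \dim W)%N = \dim {:aT} ->
  lker (hom_ker_img S W) = S /\ limg (hom_ker_img S W) = W.
Proof.
move=> dimSW; rewrite /hom_ker_img.
have dimSC : \dim S^C%VS = \dim W by rewrite dimv_compl -dimSW addKn.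
case: linear_of_free => f /= fP.
have bX : free (vbasis S^C%VS ++ vbasis S).
  rewrite cat_free !(basis_free (vbasisP _)) /= !(span_basis (vbasisP _)).
  by rewrite directv_addE /= !directv_trivial /= capvC capv_compl.
have szX : size (vbasis W ++ nseq (\dim S) 0) = size (vbasis S^C%VS ++ vbasis S).
  by rewrite !size_cat size_nseq !size_tuple dimSC.
have := fP bX szX; rewrite map_cat => /eqP.
rewrite eqseq_cat ?size_map ?size_tuple // => /andP[/eqP fSC /eqP fS].
have imgSC : (linfun f @: S^C)%VS = W.
  rewrite -[in LHS](span_basis (vbasisP S^C%VS)) limg_span.
  by rewrite (eq_map (lfunE f)) fSC (span_basis (vbasisP W)).
have imgS : (linfun f @: S)%VS = 0%VS.
  rewrite -[in LHS](span_basis (vbasisP S)) limg_span (eq_map (lfunE f)) fS.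
  by apply/eqP; rewrite -subv0; apply/span_subvP=> _ /nseqP[-> _]; exact: mem0v.
have img : limg (linfun f) = W.
  by rewrite -(addv_complf S) limgD imgS imgSC add0v.
split=> //; apply/esym/eqP.
have sSker : (S <= lker (linfun f))%VS by rewrite lkerE imgS.
rewrite eqEdim sSker /=.
have := limg_ker_dim (linfun f) fullv; rewrite img capfv -dimSW.
by move/addIn => ->.
Qed.

End KernelImage.

(** * Gluing two linear maps side by side *)

Section Glue.

Set Implicit Arguments.
Unset Strict Implicit.
Unset Printing Implicit Defensive.

Import GRing.Theory.
Local Open Scope ring_scope.

Section GlueDef.

Variables (K : fieldType) (vT : vectType K) (m p : nat).
Variables (f : 'Hom(vT, 'rV[K]_m)) (g : 'Hom(vT, 'rV[K]_p)).

Definition glue_fun (v : vT) : 'rV[K]_(m + p) := row_mx (f v) (g v).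

Lemma glue_fun_is_linear : linear glue_fun.
Proof.
by move=> a u v; rewrite /glue_fun !linearP scale_row_mx add_row_mx.
Qed.

HB.instance Definition _ :=
  GRing.isLinear.Build K vT 'rV[K]_(m + p) *:%R glue_fun glue_fun_is_linear.

(** The linear map v |-> (f v, g v), with F^m x F^p encoded as F^(m + p). *)
Definition glue : 'Hom(vT, 'rV[K]_(m + p)) := linfun glue_fun.

Lemma glueE v : glue v = row_mx (f v) (g v).
Proof. by rewrite lfunE. Qed.

Lemma lker_glue : lker glue = (lker f :&: lker g)%VS.
Proof.
apply/vspaceP=> v; rewrite memv_cap !memv_ker glueE.
by rewrite -[0 in LHS]row_mx0; apply/eqP/andP=> [/eq_row_mx[-> ->]|[/eqP-> /eqP->]].
Qed.

End GlueDef.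

Lemma dim_limg_le (K : fieldType) (aT rT : vectType K) (f : 'Hom(aT, rT))
  (U : {vspace aT}) : (\dim (f @: U) <= \dim U)%N.
Proof. by rewrite -(limg_ker_dim f U) leq_addl. Qed.

(** Rank-nullity for the projection of the intersection to the first m
    coordinates: vectors in its kernel come from U :&: lker f. *)
Lemma dim_glue_cap (K : fieldType) (aT bT : vectType K) (m p : nat)
    (f : 'Hom(aT, 'rV[K]_m)) (g : 'Hom(aT, 'rV[K]_p))
    (f' : 'Hom(bT, 'rV[K]_m)) (g' : 'Hom(bT, 'rV[K]_p))
    (U : {vspace aT}) (V : {vspace bT}) :
  (\dim (glue f g @: U :&: glue f' g' @: V)
     <= \dim (limg f :&: limg f') + \dim (U :&: lker f))%N.
Proof.
set X := (_ :&: glue f' g' @: V)%VS.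
pose pr : 'Hom('rV[K]_(m + p), 'rV[K]_m) := linfun lsubmx.
rewrite -(limg_ker_dim pr X) addnC leq_add //.
  apply: dimvS; apply/subvP=> _ /memv_imgP[x + ->].
  case/memv_capP=> /memv_imgP[u Uu xu] /memv_imgP[v Vv xv].
  rewrite memv_cap !lfunE /= {1}xu xv !glueE !row_mxKl.
  by rewrite !memv_img ?memvf.
apply: leq_trans (dim_limg_le (glue f g) _); apply: dimvS.
apply/subvP=> _ /memv_capP[/memv_capP[/memv_imgP[u Uu ->] _]].
rewrite memv_ker lfunE /= glueE row_mxKl -memv_ker => fu0.
by rewrite -glueE memv_img // memv_cap Uu.
Qed.

End Glue.

(** * Codes in terms of intersections *)

Section Codes.
Local Open Scope nat_scope.

Set Implicit Arguments.
Unset Strict Implicit.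
Unset Printing Implicit Defensive.

Lemma subspace_distE (F : finFieldType) (n d k : nat)
    (U V : {vspace 'rV[F]_n}) :
  ~~ odd d -> d <= 2 * k -> \dim U = k -> \dim V = k ->
  (d <= subspace_dist U V) = (\dim (U :&: V) <= k - d./2).
Proof.
move=> d_even d_le dU dV; rewrite /subspace_dist.
have := dimv_sum_cap U V; rewrite dU dV.
have := dimvS (capvSl U V); rewrite dU.
have := even_halfK d_even.
move: (\dim (U + V)) (\dim (U :&: V)) => x y; lia.
Qed.

(** For even d <= 2k, k-dimensional spaces U and V are at distance
    2k - 2 dim (U :&: V), so the distance condition bounds intersections. *)
Lemma is_CDCP (F : finFieldType) (n d k : nat) (C : {fset {vspace 'rV[F]_n}}) :
  ~~ odd d -> d <= 2 * k ->
  is_CDC d k C <->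
    (forall U, U \in C -> \dim U = k) /\
    (forall U V, U \in C -> V \in C -> U != V -> \dim (U :&: V) <= k - d./2).
Proof.
move=> d_even d_le; split=> -[dimC distC]; split=> // U V UC VC UV.
  by rewrite -(subspace_distE d_even d_le) ?distC // dimC.
by rewrite (subspace_distE d_even d_le) ?distC // dimC.
Qed.

(** Both codewords lie in the union of the parts of index at most i, whose
    distance 2k - 2i amounts to intersections of dimension at most i. *)
Lemma distance_partition_cap (F : finFieldType) (n d k : nat)
    (C : {fset {vspace 'rV[F]_n}})
    (Cs : 'I_(k - d./2).+1 -> {fset {vspace 'rV[F]_n}})
    (i j : 'I_(k - d./2).+1) (W W' : {vspace 'rV[F]_n}) :
  is_distance_partition d k C Cs -> j <= i ->
  W \in Cs i -> W' \in Cs j -> W != W' -> \dim (W :&: W') <= i.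
Proof.
case=> _ _ /(_ i) CDCi le_ji Wi W'j neqW.
have ik : i <= k by have := ltn_ord i; lia.
have [| |_ capi] := (is_CDCP _ _ _).1 CDCi.
- by rewrite -mulnBr mul2n odd_double.
- exact: leq_subr.
have := capi W W'; rewrite -mulnBr mul2n doubleK subKn //; apply=> //.
  by apply/bigfcupP; exists i; rewrite ?mem_index_enum ?leqnn.
by apply/bigfcupP; exists j; rewrite ?mem_index_enum.
Qed.

Lemma card_bigfcup_disjoint (I : finType) (T : choiceType)
    (B : I -> {fset T}) :
  (forall i j, i != j -> [disjoint B i & B j]%fset) ->
  #|` \big[fsetU/fset0]_i B i| = \sum_i #|` B i|.
Proof.
move=> disjB; elim: (index_enum I) (index_enum_uniq I) => [|i l IHl] /=.
  by rewrite !big_nil cardfs0.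
case/andP=> il /IHl {}IHl; rewrite !big_cons cardfsU IHl.
suff -> : (B i `&` \big[fsetU/fset0]_(j <- l) B j = fset0)%fset.
  by rewrite cardfs0 subn0.
apply/eqP; rewrite fsetI_eq0; apply/fdisjointP=> x xi.
apply/negP=> /bigfcupP[j]; rewrite andbT => jl xj.
have ij : i != j by apply: contraNneq il => ->.
by have /fdisjointP/(_ x xi) := disjB i j ij; rewrite xj.
Qed.

Lemma card_fsetM (T T' : choiceType) (A : {fset T}) (B : {fset T'}) :
  #|` A `*` B|%fset = #|` A| * #|` B|.
Proof.
rewrite -[RHS](size_allpairs pair); apply/perm_size.
apply: uniq_perm => [||u]; first exact: fset_uniq.
  by apply: allpairs_uniq; rewrite ?fset_uniq // => -[x y] [x' y'].
rewrite in_fsetM; apply/andP/allpairsP => [[uA uB]|[v [vA vB ->]]] //.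
by exists u; split=> //; case: (u).
Qed.

End Codes.

(** * The glued code *)

(* rev_ord i : 'I_r.+1 is the index r - i, where r = k - d./2 *)
Theorem lemma5p3 (F : finFieldType) (k s t d : nat)
    (k_gt0 : 0 < k) (s_gt0 : 0 < s) (t_gt0 : 0 < t)
    (d_even : ~~ odd d) (d_range : 2 <= d <= 2 * k)
    (C : {fset {vspace 'rV[F]_(k + t)}}) (HC : is_CDC d k C)
    (Cs : 'I_(k - d./2).+1 -> {fset {vspace 'rV[F]_(k + t)}})
    (HCs : is_distance_partition d k C Cs)
    (Ds : 'I_(k - d./2).+1 -> {fset {vspace 'rV[F]_(k + s)}})
    (HDs : is_CDC_sequence d k Ds)
    (A : {fset {vspace 'rV[F]_s}}) (HA : is_CDC d k A) :
  exists C' : {fset {vspace 'rV[F]_(k + s + t)}},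
    is_CDC d k C' /\
    #|` C'| = #|` A| + \sum_(i < (k - d./2).+1) #|` Cs i| * #|` Ds (rev_ord i)|.
Proof.
(* The ambient space is read as F^(k + t) x F^s. *)
rewrite addnAC; case/andP: d_range => d_ge2 d_le.
have r_lt_k : k - d./2 < k by have := even_halfK d_even; lia.
have dimF n : \dim {:'rV[F]_n} = n by rewrite dimvf /dim /= mul1n.
have [dimA capA] := (is_CDCP _ d_even d_le).1 HA.
have dimC i W : W \in Cs i -> \dim W = k.
  case: HC => dimC _ Wi; apply: dimC; case: HCs => -> _ _.
  by apply/bigfcupP; exists i; rewrite ?mem_index_enum.
have dimD i U : U \in Ds i -> \dim U = k.
  by case: (HDs i) => -[dimD _] _; exact: dimD.
have capD i U U' : U \in Ds i -> U' \in Ds i -> U != U' ->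
    \dim (U :&: U') <= k - d./2.
  by case: (HDs i) => /(is_CDCP _ d_even d_le)[_ +] _; apply.
have /fin_all_exists[S HS] : forall i, exists S : {vspace 'rV[F]_(k + s)},
    \dim S = s /\ forall U, U \in Ds i -> \dim (U :&: S) <= i.
  move=> i; case: (HDs i) => _ [U [S [_ dimS _ capS]]].
  by exists S; rewrite dimS addKn.
(* The space that comes with Ds (rev_ord i) plays the role of S_(r - i). *)
pose phi i W : 'Hom('rV[F]_(k + s), 'rV[F]_(k + t)) :=
  hom_ker_img (S (rev_ord i)) W.
pose sigma i : 'Hom('rV[F]_(k + s), 'rV[F]_s) :=
  hom_ker_img (S (rev_ord i))^C%VS fullv.
pose psi i W := glue (phi i W) (sigma i).
have phiP i W : W \in Cs i -> lker (phi i W) = S (rev_ord i) /\ limg (phi i W) = W.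
  move=> Wi; apply: hom_ker_imgP.
  by rewrite dimF (dimC i W Wi) (HS _).1 addnC.
have sigmaP i : lker (sigma i) = (S (rev_ord i))^C%VS.
  apply: proj1 (hom_ker_imgP _).
  by rewrite dimv_compl !dimF (HS _).1 addnK addnC.
have psi_inj i W : W \in Cs i -> lker (psi i W) == 0%VS.
  by move=> Wi; rewrite lker_glue (phiP i W Wi).1 sigmaP capv_compl.
pose emb : 'Hom('rV[F]_s, 'rV[F]_(k + t + s)) := glue 0%R \1%VF.
have emb_inj : lker emb == 0%VS.
  rewrite lker_glue; apply/eqP/vspaceP=> v.
  by rewrite memv_cap !memv_ker !lfunE /= eqxx memv0.
pose X i (WU : {vspace 'rV[F]_(k + t)} * {vspace 'rV[F]_(k + s)}) :=
  (psi i WU.1 @: WU.2)%VS.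
have dimX i WU : WU.1 \in Cs i -> WU.2 \in Ds (rev_ord i) -> \dim (X i WU) = k.
  move=> Wi Ui; apply: etrans (dimD _ _ Ui).
  by rewrite limg_dim_eq // (eqP (psi_inj _ _ Wi)) capv0.
have dimE U : U \in A -> \dim (emb @: U) = k.
  move=> UA; apply: etrans (dimA _ UA).
  by rewrite limg_dim_eq // (eqP emb_inj) capv0.
have capE U V : U \in A -> V \in A -> U != V ->
    \dim (emb @: U :&: emb @: V) <= k - d./2.
  move=> UA VA UV; rewrite -(lker0_img_cap _ _ emb_inj).
  by rewrite (leq_trans (dim_limg_le _ _)) ?capA.
have capker i W U : W \in Cs i -> U \in Ds (rev_ord i) ->
    \dim (U :&: lker (phi i W)) <= rev_ord i.
  by move=> Wi Ui; rewrite (phiP i W Wi).1 (HS _).2.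
have capXE i WU V : WU.1 \in Cs i -> WU.2 \in Ds (rev_ord i) ->
    \dim (X i WU :&: emb @: V) <= k - d./2.
  move=> Wi Ui; apply: leq_trans (dim_glue_cap _ _ _ _ _ _) _.
  have -> : limg (0%R : 'Hom('rV[F]_s, 'rV[F]_(k + t))) = 0%VS.
    by apply/eqP; rewrite -lkerE; apply/subvP=> v _; rewrite memv_ker lfunE.
  rewrite capv0 dimv0 add0n (leq_trans (capker _ _ _ Wi Ui)) //.
  by rewrite -ltnS.
have capX_le (i j : 'I_(k - d./2).+1) WU WU' : j <= i ->
    WU.1 \in Cs i -> WU.2 \in Ds (rev_ord i) ->
    WU'.1 \in Cs j -> WU'.2 \in Ds (rev_ord j) ->
    WU.1 != WU'.1 -> \dim (X i WU :&: X j WU') <= k - d./2.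
  move=> le_ji Wi Ui Wj Uj neqW.
  apply: leq_trans (dim_glue_cap _ _ _ _ _ _) _.
  have := capker _ _ _ Wi Ui.
  rewrite (phiP i _ Wi).2 (phiP j _ Wj).2 /=.
  have := distance_partition_cap HCs le_ji Wi Wj neqW.
  have := ltn_ord i.
  by move: (\dim _) (\dim _) => x y; lia.
have disjC i j W : W \in Cs i -> W \in Cs j -> i = j.
  move=> Wi Wj; apply/eqP/negPn/negP => ij.
  case: HCs => _ /(_ i j ij)/fdisjointP/(_ W Wi) + _.
  by rewrite Wj.
have capX i j WU WU' :
    WU.1 \in Cs i -> WU.2 \in Ds (rev_ord i) ->
    WU'.1 \in Cs j -> WU'.2 \in Ds (rev_ord j) ->
    WU != WU' -> \dim (X i WU :&: X j WU') <= k - d./2.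
  move=> Wi Ui Wj Uj; case: (eqVneq WU.1 WU'.1) => [eqW|neqW] neq.
    rewrite -eqW in Wj; have ij := disjC _ _ _ Wi Wj; subst j.
    have neqU : WU.2 != WU'.2.
      apply: contraNneq neq => eqU.
      by rewrite [WU]surjective_pairing eqW eqU -surjective_pairing.
    rewrite /X -eqW -(lker0_img_cap _ _ (psi_inj _ _ Wi)).
    by rewrite (leq_trans (dim_limg_le _ _)) // (capD _ _ _ Ui Uj).
  case/orP: (leq_total j i) => le; first exact: capX_le.
  by rewrite capvC; apply: capX_le; rewrite // eq_sym.
pose B i := [fset X i WU | WU in Cs i `*` Ds (rev_ord i)]%fset.
have BP i Y : Y \in B i -> exists2 WU,
    (WU.1 \in Cs i) /\ (WU.2 \in Ds (rev_ord i)) & Y = X i WU.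
  by case/imfsetP=> WU /=; rewrite in_fsetM => /andP[? ?] ->; exists WU.
(* As r < k, a k-dimensional space that meets another one in dimension at most r
   is different from it. *)
have neq_cap n (Y Z : {vspace 'rV[F]_n}) : \dim Y = k ->
    \dim (Y :&: Z) <= k - d./2 -> Y != Z.
  move=> dimY; apply: contraTneq => <-.
  by rewrite capvv dimY -ltnNge.
exists ((fun U => emb @: U)%VS @` A `|` \big[fsetU/fset0]_i B i)%fset; split.
  apply/is_CDCP => //; split=> [Y|Y Z].
    case/fsetUP=> [/imfsetP[U /= UA ->]|/bigfcupP[i _ /BP[WU [Wi Ui] ->]]].
      exact: dimE.
    exact: dimX.
  case/fsetUP=> [/imfsetP[U /= UA ->]|/bigfcupP[i _ /BP[WU [Wi Ui] ->]]].
    case/fsetUP=> [/imfsetP[V /= VA ->]|/bigfcupP[j _ /BP[WU' [Wj Uj] ->]]] neq.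
      by apply: capE => //; apply: contraNneq neq => ->.
    by rewrite capvC; exact: capXE.
  case/fsetUP=> [/imfsetP[V /= VA ->]|/bigfcupP[j _ /BP[WU' [Wj Uj] ->]]] neq.
    exact: capXE.
  apply: capX => //; apply: contraNneq neq => eqWU; rewrite -eqWU in Wj *.
  by rewrite (disjC _ _ _ Wi Wj).
rewrite cardfsU.
have -> : ((fun U => emb @: U)%VS @` A `&` \big[fsetU/fset0]_i B i = fset0)%fset.
  apply/eqP; rewrite fsetI_eq0; apply/fdisjointP=> Y /imfsetP[U /= UA ->].
  apply/negP=> /bigfcupP[i _ /BP[WU [Wi Ui] eqY]].
  have := capXE i WU U Wi Ui; move/(neq_cap _ _ _ (dimX _ _ Wi Ui)).
  by rewrite eqY eqxx.
rewrite cardfs0 subn0 card_imfset /=; last first.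
  by move=> U V /eqP; rewrite eq_limg_ker0 // => /eqP.
rewrite card_bigfcup_disjoint => [|i j ij]; last first.
  apply/fdisjointP=> _ /BP[WU [Wi Ui] ->]; apply/negP=> /BP[WU' [Wj Uj] eqX].
  have neq : WU != WU'.
    by apply: contraNneq ij => eqWU; rewrite -eqWU in Wj; rewrite (disjC _ _ _ Wi Wj).
  have /(neq_cap _ _ _ (dimX _ _ Wi Ui)) := capX _ _ _ _ Wi Ui Wj Uj neq.
  by rewrite eqX eqxx.
congr (_ + _); apply: eq_bigr => i _.
rewrite card_in_imfset /= => [|WU WU']; last first.
  rewrite !in_fsetM => /andP[Wi Ui] /andP[Wj Uj] eqX.
  apply/eqP/negPn/negP=> neq.
  have /(neq_cap _ _ _ (dimX _ _ Wi Ui)) := capX _ _ _ _ Wi Ui Wj Uj neq.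
  by rewrite eqX eqxx.
by rewrite card_fsetM.
Qed.
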